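(* Let $X=X(\Omega,\mu;q)$, $0<q\le1$, be a quasi-Banach lattice and let $\mathcal{F}_n$ be a subspace of $X\cap C(\mathbb{R}^d)$, depending on a parameter $n$, whose elements are infinitely differentiable. Assume that there exist $\beta>0$ and a nonnegative function $\varphi_n$ on $\Omega$ such that for all $\alpha\in\mathbb{Z}_+^d$ $$\|\varphi_n^{|\alpha|_1}D^\alpha F_n\|_X\le B_\alpha n^{\beta|\alpha|_1}\|F_n\|_X,\qquad F_n\in\mathcal{F}_n,$$ with $B_\alpha>0$. Then the following assertions hold. (A) For each $F_n\in\mathcal{F}_n$ and any constant $A>0$ satisfying $$\eta:=\sum_{\alpha\in\mathbb{Z}_+^d\setminus\{0\}}\left(\frac{A^{|\alpha|_1}B_\alpha}{\alpha!}\right)^q<1,$$ we have $$\frac1{(1+\eta)^{1/q}}\bigg\|\max_{t\in Q\left(x,\frac{A\varphi_n(x)}{n^\beta}\right)}|F_n(t)|\bigg\|_X\le\|F_n\|_X\le\frac1{(1-\eta)^{1/q}}\bigg\|\min_{t\in Q\left(x,\frac{A\varphi_n(x)}{n^\beta}\right)}|F_n(t)|\bigg\|_X .$$ (B) The left-hand side inequality above holds for any $A>0$, that is, without requiring $\eta<1$.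
   Context: $\Omega\subset\mathbb{R}^d$ is a domain endowed with a positive $\sigma$-finite measure $\mu$. A quasi-Banach (function) lattice $X=X(\Omega,\mu;q)$, $0<q\le1$, is a complete space of functions on $\Omega$ with a functional $\|\cdot\|_X:X\to\mathbb{R}_+$ such that: 1) $\|f\|_X=0$ iff $f=0$; 2) $\|\lambda f\|_X=|\lambda|\|f\|_X$ for $\lambda\in\mathbb{C}$; 3) $\|f+g\|_X^q\le\|f\|_X^q+\|g\|_X^q$; 4) if $|f|\le|g|$ then $\|f\|_X\le\|g\|_X$ for $f,g\in X$; 5) $\chi_B\in X$ for all $B\subset\Omega$ with $\mu(B)<\infty$. The parameter $n$ is a natural number or a positive real number. For $\alpha\in\mathbb{Z}_+^d$, $|\alpha|_1=\alpha_1+\dots+\alpha_d$, $\alpha!=\alpha_1!\cdots\alpha_d!$, $D^\alpha=\partial^{|\alpha|_1}/\partial x_1^{\alpha_1}\cdots\partial x_d^{\alpha_d}$. $Q(x,\delta)=\{y\in\Omega:\|x-y\|_\infty\le\delta\}$. The norms of the maximal and minimal expressions are taken with respect to the variable $x$.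
   Formalization: Added since the claim fails for merely smooth functions: for x, t in Ω, if the Taylor series of F_n at x converges absolutely at t, its sum is F_n(t) (true for analytic functions on R^d). X is solid: measurable f with |f| ≤ |g| a.e., g in X, lies in X; max/min are read as sup/inf. *)

(* Defs.v *)
From HB Require Import structures.
From mathcomp Require Import all_boot all_order all_algebra.
From mathcomp Require Import all_classical all_reals all_analysis.
From mathcomp.real_closed Require Import complex.

Set Implicit Arguments.
Unset Strict Implicit.
Unset Printing Implicit Defensive.

Import Order.TTheory GRing.Theory Num.Theory.
Import numFieldNormedType.Exports.
Import Normc.

#[local] Open Scope classical_set_scope.
#[local] Open Scope complex_scope.
#[local] Open Scope ring_scope.

Section Smooth.
Context {R : realType} {d : nat}.
Implicit Types (a : {ffun 'I_d -> nat}) (F : 'rV[R]_d -> R[i]).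

Definition mnorm1 a : nat := (\sum_i a i)%N.

Definition mfact a : nat := (\prod_i (a i)`!)%N.

Definition monomial a (v : 'rV[R]_d) : R := \prod_i v ord0 i ^+ a i.

Definition partials (s : seq 'I_d) (f : 'rV[R]_d -> R) : 'rV[R]_d -> R :=
  foldr (fun i g x => 'D_(delta_mx ord0 i) g x) f s.

Definition smooth (f : 'rV[R]_d -> R) : Prop :=
  forall s : seq 'I_d, continuous (partials s f) /\
    forall (i : 'I_d) (x : 'rV[R]_d),
      derivable (partials s f) x (delta_mx ord0 i).

Definition mderiv a (f : 'rV[R]_d -> R) : 'rV[R]_d -> R :=
  partials (flatten [seq nseq (a i) i | i <- enum 'I_d]) f.

(* Complex-valued functions of real variables are handled through their real
   and imaginary parts: [R[i]] is a normed space over itself, not over [R]. *)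
Definition cfun_continuous F : Prop :=
  continuous (fun x => complex.Re (F x)) /\ continuous (fun x => complex.Im (F x)).

Definition cfun_smooth F : Prop :=
  smooth (fun x => complex.Re (F x)) /\ smooth (fun x => complex.Im (F x)).

Definition cfun_mderiv a F : 'rV[R]_d -> R[i] :=
  fun x => mderiv a (fun y => complex.Re (F y)) x +i* mderiv a (fun y => complex.Im (F y)) x.

Definition taylor_poly F (x : 'rV[R]_d) (N : nat) (t : 'rV[R]_d) : R[i] :=
  \sum_(b : {ffun 'I_d -> 'I_N.+1} | (\sum_i b i <= N)%N)
    let a : {ffun 'I_d -> nat} := [ffun i => nat_of_ord (b i)] in
    cfun_mderiv a F x * (monomial a (t - x) / (mfact a)%:R)%:C.

Definition taylor_summable F (x t : 'rV[R]_d) : Prop :=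
  (\esum_(a in [set: {ffun 'I_d -> nat}])
    (normc (cfun_mderiv a F x) * `|monomial a (t - x)| / (mfact a)%:R)%:E
   < +oo)%E.

(* On [Omega], [F] is the sum of its Taylor series wherever that series
   converges absolutely.  Entire functions (polynomials, trigonometric
   polynomials, functions of exponential type) satisfy this for all [Omega].
   Smoothness alone does not let derivatives at [x] control [F] near [x]:
   if d = 1, mu is the Dirac mass at 0, ||f|| = |f(0)|, phi = 1 and
   F(x) = 1 + exp(- 1 / x ^ 2), then ||phi ^ k F^(k)|| = 0 for all k > 0, so
   that the constants B_k, k > 0, can be arbitrarily small, whereas ||F|| = 1
   and max |F| > 1 on [-A, A]. *)
Definition sum_of_taylor_series (Omega : set 'rV[R]_d) F : Prop :=
  forall x t, Omega x -> Omega t -> taylor_summable F x t ->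
    normc (F t - taylor_poly F x N t) @[N --> \oo] --> (0 : R).

(* [`| y |] on ['rV[R]_d] is the sup norm. *)
Definition cube (Omega : set 'rV[R]_d) (x : 'rV[R]_d) (r : R) :
    set 'rV[R]_d :=
  [set y | Omega y /\ `|x - y| <= r].

(* [cube Omega x r] need not be compact, hence sup and inf; these are over
   bounded sets when [F] is continuous on the whole space. *)
Definition max_cube (Omega : set 'rV[R]_d) (r : 'rV[R]_d -> R) F :
    'rV[R]_d -> R[i] :=
  fun x => (sup [set normc (F t) | t in cube Omega x (r x)])%:C.

Definition min_cube (Omega : set 'rV[R]_d) (r : 'rV[R]_d -> R) F :
    'rV[R]_d -> R[i] :=
  fun x => (inf [set normc (F t) | t in cube Omega x (r x)])%:C.

Definition fun_subspace (S : set ('rV[R]_d -> R[i])) : Prop :=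
  S (fun=> 0) /\
  forall (c : R[i]) F G, S F -> S G -> S (fun x => c * F x + G x).

Definition domain (Omega : set 'rV[R]_d) : Prop :=
  [/\ open Omega, connected Omega & Omega !=set0].

End Smooth.

Section Lattice.
Context {R : realType} {d : nat} {G : set (set 'rV[R]_d)}.
Variables (Omega : set 'rV[R]_d)
  (mu : {measure set (g_sigma_algebraType G) -> \bar R}) (q : R).
Implicit Types f g : 'rV[R]_d -> R[i].

Definition cfun_measurable f : Prop :=
  measurable_fun (Omega : set (g_sigma_algebraType G))
    (fun x : g_sigma_algebraType G => complex.Re (f x)) /\
  measurable_fun (Omega : set (g_sigma_algebraType G))
    (fun x : g_sigma_algebraType G => complex.Im (f x)).

(* Functions on [Omega] are represented by functions on the whole space whose
   values outside [Omega] are irrelevant (by [qbl_solid]), and are identified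
   when equal mu-a.e. on [Omega].  [nrm] is meaningful on [X] only. *)
Record quasi_banach_lattice (X : set ('rV[R]_d -> R[i]))
    (nrm : ('rV[R]_d -> R[i]) -> R) : Prop := QuasiBanachLattice {
  qbl_measurable : forall f, X f -> cfun_measurable f ;
  qbl_add : forall f g, X f -> X g -> X (fun x => f x + g x) ;
  qbl_scale : forall (c : R[i]) f, X f -> X (fun x => c * f x) ;
  qbl_norm_ge0 : forall f, X f -> 0 <= nrm f ;
  qbl_norm_eq0 : forall f, X f ->
    (nrm f = 0 <-> {ae mu, forall x, Omega x -> f x = 0}) ;
  qbl_normZ : forall (c : R[i]) f, X f ->
    nrm (fun x => c * f x) = normc c * nrm f ;
  qbl_normD : forall f g, X f -> X g ->
    nrm (fun x => f x + g x) `^ q <= nrm f `^ q + nrm g `^ q ;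
  qbl_solid : forall f g, cfun_measurable f -> X g ->
    {ae mu, forall x, Omega x -> normc (f x) <= normc (g x)} ->
    X f /\ nrm f <= nrm g ;
  qbl_indic : forall B : set (g_sigma_algebraType G),
    measurable B -> B `<=` Omega -> (mu B < +oo)%E ->
    X (fun x => (\1_B x)%:C) ;
  qbl_complete : forall u : nat -> 'rV[R]_d -> R[i],
    (forall k, X (u k)) ->
    (forall e : R, 0 < e -> exists K, forall k l, (K <= k)%N -> (K <= l)%N ->
       nrm (fun x => u k x - u l x) < e) ->
    exists2 f, X f & nrm (fun x => u k x - f x) @[k --> \oo] --> (0 : R) }.

End Lattice.

(* The norm of [X], equal to +oo outside [X]: an upper bound on [xnorm X nrm f]
   by a real number contains the assertion that [f] is in [X]. *)
Definition xnorm {R : realType} {d : nat} (X : set ('rV[R]_d -> R[i]))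
    (nrm : ('rV[R]_d -> R[i]) -> R) (f : 'rV[R]_d -> R[i]) : \bar R :=
  if `[< X f >] then (nrm f)%:E else +oo%E.

Definition taylor_eta {R : realType} {d : nat} (q : R)
    (B : {ffun 'I_d -> nat} -> R) (A : R) : \bar R :=
  \esum_(a in [set a : {ffun 'I_d -> nat} | a != 0%R])
    ((A ^+ mnorm1 a * B a / (mfact a)%:R) `^ q)%:E.

(* Main.v *)
Require Import Defs.
From HB Require Import structures.
From mathcomp Require Import all_boot all_order all_algebra.
From mathcomp Require Import all_classical all_reals all_analysis.
From mathcomp Require Import measurable_realfun.
From mathcomp.real_closed Require Import complex.
From mathcomp Require Import lra ring.

Set Implicit Arguments.
Unset Strict Implicit.
Unset Printing Implicit Defensive.

Import Order.TTheory GRing.Theory Num.Theory.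
Import numFieldNormedType.Exports.
Import Normc.

#[local] Open Scope classical_set_scope.
#[local] Open Scope complex_scope.
#[local] Open Scope ring_scope.

(* For [x] in [Omega] and [t] in the cube of radius [r(x) = A phi(x) / n ^ beta]
   around [x], Taylor's formula gives
     [|F(t) - F(x)| <= sum_(a <> 0) |D^a F(x)| r(x) ^ |a| / a!].
   By the Bernstein-type hypothesis the q-th powers of the norms of the terms on
   the right sum to at most [eta ||F||^q], so by completeness the right-hand side
   is dominated almost everywhere by some [|f|] with [||f||^q <= eta ||F||^q].
   Both inequalities then follow from [max |F| <= |F| + |f|] and
   [|F| <= min |F| + |f|] by solidity and q-subadditivity of the norm.

   Solidity requires [max |F|] and [min |F|] to be measurable although [phi] is
   not assumed to be: either [F] is constant on [Omega], or [phi] can be recovered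
   from the measurable functions [phi ^ |a| D^a F]. *)

(** * Preliminaries on complex moduli, real powers and unordered sums *)

Section ComplexModulus.
Context {R : realType}.
Implicit Types z w : R[i].

Lemma normc_ge0 z : 0 <= normc z.
Proof. by case: z => a b; rewrite /normc sqrtr_ge0. Qed.

Lemma ler_normcD z w : normc (z + w) <= normc z + normc w.
Proof. exact: (@le_normcD _ z w). Qed.

Lemma normcN z : normc (- z) = normc z.
Proof. by case: z => a b; rewrite /normc /= !sqrrN. Qed.

Lemma normc_real (a : R) : normc a%:C = `|a|.
Proof. by rewrite /normc /= expr0n /= addr0 sqrtr_sqr. Qed.

Lemma normc_id z : normc (normc z)%:C = normc z.
Proof. by rewrite normc_real ger0_norm ?normc_ge0. Qed.

Lemma Re_le_normc z : `|complex.Re z| <= normc z.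
Proof.
by case: z => a b /=; rewrite -sqrtr_sqr ler_sqrt ?lerDl ?addr_ge0 ?sqr_ge0.
Qed.

Lemma normc_sum (I : Type) (r : seq I) (P : pred I) (F : I -> R[i]) :
  normc (\sum_(i <- r | P i) F i) <= \sum_(i <- r | P i) normc (F i).
Proof.
elim/big_rec2 : _ => [|i x y _ le_yx]; first by rewrite normc0.
by rewrite (le_trans (ler_normcD _ _))// lerD2l.
Qed.

End ComplexModulus.

Section PowRoot.
Context {R : realType} {q : R}.
Hypothesis q0 : 0 < q.

Lemma lt_powR_root (a b : R) : 0 <= a -> 0 <= b -> a `^ q < b `^ q -> a < b.
Proof.
move=> a0 b0; rewrite !ltNge; apply: contra => ba.
by apply: ge0_ler_powR; rewrite ?nnegrE// ltW.
Qed.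

Lemma le_powR_root (a b : R) : 0 <= a -> 0 <= b -> a `^ q <= b `^ q -> a <= b.
Proof.
move=> a0 b0; apply: contraTT; rewrite -!ltNge => ba.
by apply: gt0_ltr_powR; rewrite ?nnegrE.
Qed.

End PowRoot.

Lemma ler_coord_norm {R : realType} {d : nat} (v : 'rV[R]_d) i :
  `|v ord0 i| <= `|v|.
Proof.
rewrite [leRHS]/Num.Def.normr /= mx_normrE.
exact: (le_bigmax _ (fun j => `|v j.1 j.2|) (ord0, i)).
Qed.

Section AlmostEverywhere.
Context {d} {T : ringOfSetsType d} {R : realFieldType}.
Variable mu : {measure set T -> \bar R}.

Lemma ae_imply (P Q : T -> Prop) : (forall x, P x -> Q x) ->
  {ae mu, forall x, P x} -> {ae mu, forall x, Q x}.
Proof. by move=> PQ; apply: filterS. Qed.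

End AlmostEverywhere.

(** Encoding the indices by [pickle] turns an unordered sum into an ordinary series: codes of no
    element of [D] contribute 0, and injectivity of [pickle] counts each element once. Linearity and
    limit results for series then become applicable. *)
Lemma esum_countE {R : realType} (I : countType) (D : set I) (a : I -> \bar R) :
  (forall i, D i -> (0 <= a i)%E) ->
  (\esum_(i in D) a i = \sum_(k <oo)
    if pickle_inv k is Some i then if i \in D then a i else 0 else 0)%E.
Proof.
move=> a0; rewrite nneseries_esumT; last first.
  by move=> k; case: (pickle_inv k) => [i|]//; case: ifPn => // /set_mem/a0.
pose b k : \bar R :=
  (if pickle_inv k is Some i then if i \in D then a i else 0 else 0)%E.
have inj_pickle : set_inj D (@pickle I).
  by move=> i j _ _; exact: (pcan_inj pickleK).
transitivity (\esum_(i in D) b (pickle i))%E.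
  by apply: eq_esum => i Di; rewrite /b pickleK_inv mem_set.
rewrite -(@esum_image _ _ _ _ _ b)// esum_mkcond; apply: eq_esum => k _.
case: ifPn => //; rewrite notin_setE /b => nDk.
move: (@pickle_invK I k); case: (pickle_inv k) => [i|]//= ik.
by case: ifPn => // /set_mem Di; exfalso; apply: nDk; exists i.
Qed.

Lemma esumZl {R : realType} (I : countType) (D : set I) (a : I -> \bar R) (c : R) :
  0 <= c -> (forall i, D i -> (0 <= a i)%E) ->
  (\esum_(i in D) (c%:E * a i) = c%:E * \esum_(i in D) a i)%E.
Proof.
move=> c0 a0; rewrite !esum_countE//; last by move=> i Di; rewrite mule_ge0// a0.
rewrite -nneseriesZl//; last first.
  by move=> k _; case: (pickle_inv k) => [i|]//; case: ifPn => // /set_mem/a0.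
apply: eq_eseriesr => k _; case: (pickle_inv k) => [i|]; last by rewrite mule0.
by case: ifP; rewrite // mule0.
Qed.

Lemma esum_ge_uniq {R : realType} (I : choiceType) (D : set I) (a : I -> \bar R)
    (s : seq I) :
  uniq s -> (forall i, i \in s -> D i) ->
  (\sum_(i <- s) a i <= \esum_(i in D) a i)%E.
Proof.
by move=> us sD; rewrite fsbig_seq//; apply: esum_ge; exists [set` s].
Qed.

(** * Series in a quasi-Banach lattice *)

Section Lattice.
Context {R : realType} {d : nat} {G : set (set 'rV[R]_d)}.
Variables (Omega : set 'rV[R]_d)
  (mu : {measure set (g_sigma_algebraType G) -> \bar R}) (q : R) (q0 : 0 < q).
Variables (X : set ('rV[R]_d -> R[i])) (nrm : ('rV[R]_d -> R[i]) -> R).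
Hypothesis hX : quasi_banach_lattice Omega mu q X nrm.
Local Notation cfmeas := (@cfun_measurable R d G Omega).

Lemma cfun_measurable_real (h : 'rV[R]_d -> R) :
  measurable_fun (Omega : set (g_sigma_algebraType G))
    (h : g_sigma_algebraType G -> R) ->
  cfmeas (fun x => (h x)%:C).
Proof. by split=> //; exact: measurable_cst. Qed.

Lemma measurable_normc f : cfmeas f ->
  measurable_fun (Omega : set (g_sigma_algebraType G))
    (fun x : g_sigma_algebraType G => normc (f x)).
Proof.
move=> [mRe mIm].
rewrite (_ : (fun _ => _) = (@Num.sqrt R) \o
    ((fun x => complex.Re (f x) ^+ 2) \+ (fun x => complex.Im (f x) ^+ 2))).
  apply: measurableT_comp.
    by apply: continuous_measurable_fun => x; exact: sqrt_continuous.
  by apply: measurable_funD; exact: measurable_funX.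
by apply/funext => x /=; case: (f x).
Qed.

Lemma qbl0 f : X f -> X (fun=> 0).
Proof.
by move=> /(qbl_scale hX 0); congr X; apply/funext => x; rewrite mul0r.
Qed.

Lemma nrm0 : X (fun=> 0) -> nrm (fun=> 0) = 0.
Proof. by move=> /(qbl_norm_eq0 hX)[_]; apply; exact: aeW. Qed.

Lemma qblN f : X f -> X (fun x => - f x) /\ nrm (fun x => - f x) = nrm f.
Proof.
move=> Xf; have -> : (fun x => - f x) = (fun x => (-1) * f x).
  by apply/funext => x; rewrite mulN1r.
by split; [exact: qbl_scale hX _ _ Xf|rewrite (qbl_normZ hX)// normcN normc1 mul1r].
Qed.

Lemma qblB f g : X f -> X g -> X (fun x => f x - g x).
Proof. by move=> Xf /qblN[Xg _]; exact: qbl_add hX _ _ Xf Xg. Qed.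

Lemma nrmBC f g : X f -> X g ->
  nrm (fun x => f x - g x) = nrm (fun x => g x - f x).
Proof.
move=> Xf Xg; have [_ <-] := qblN (qblB Xg Xf).
by congr nrm; apply/funext => x; rewrite opprB.
Qed.

Lemma qbl_normc f : X f ->
  X (fun x => (normc (f x))%:C) /\ nrm (fun x => (normc (f x))%:C) <= nrm f.
Proof.
move=> Xf; apply: (qbl_solid hX) => //.
  by apply: cfun_measurable_real; apply: measurable_normc; exact: (qbl_measurable hX).
by apply: aeW => x _; rewrite normc_id.
Qed.

Lemma qbl_sum (I : Type) (r : seq I) (u : I -> 'rV[R]_d -> R[i]) :
  X (fun=> 0) -> (forall i, X (u i)) ->
  X (fun x => \sum_(i <- r) u i x) /\
  nrm (fun x => \sum_(i <- r) u i x) `^ q <= \sum_(i <- r) nrm (u i) `^ q.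
Proof.
move=> X0 Xu; elim: r => [|i r [Xr le_r]].
  under eq_fun do rewrite big_nil.
  by rewrite big_nil nrm0// powR0// gt_eqF.
under eq_fun do rewrite big_cons.
split; first exact: qbl_add hX _ _ (Xu i) Xr.
rewrite big_cons; apply: (le_trans (qbl_normD hX (Xu i) Xr)).
by rewrite lerD2l.
Qed.

(* The norm limit [f] dominates every partial sum [s_K] of [|u_k|]: for
   [L >= K] the positive part of [s_K - Re f] is at most [|s_L - f|], whose
   norm tends to [0]. *)
Lemma qbl_series_nat (u : nat -> 'rV[R]_d -> R[i]) (c : R) :
  (forall k, X (u k)) ->
  (forall K, \sum_(0 <= k < K) nrm (u k) `^ q <= c) ->
  exists f, [/\ X f, nrm f `^ q <= c &
    {ae mu, forall x, Omega x ->
       forall K, \sum_(0 <= k < K) normc (u k x) <= normc (f x)}].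
Proof.
move=> Xu leuc.
have X0 := qbl0 (Xu 0%N).
pose v k x : R[i] := (normc (u k x))%:C.
have Xv k : X (v k) by have [] := qbl_normc (Xu k).
have le_vu k : nrm (v k) `^ q <= nrm (u k) `^ q.
  have [? ?] := qbl_normc (Xu k).
  by apply: ge0_ler_powR; rewrite ?nnegrE ?(ltW q0)//; apply: (qbl_norm_ge0 hX).
pose s K x : R[i] := \sum_(0 <= k < K) v k x.
pose S K x : R := \sum_(0 <= k < K) normc (u k x).
have sE K x : s K x = (S K x)%:C by rewrite /s /S rmorph_sum.
have Xs K : X (s K) by have [] := qbl_sum (index_iota 0 K) X0 Xv.
have S_nd K L x : (K <= L)%N -> S K x <= S L x.
  move=> KL; rewrite /S (@big_cat_nat _ _ _ K 0%N L)//= lerDl.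
  by apply: sumr_ge0 => k _; exact: normc_ge0.
pose a K := \sum_(0 <= k < K) nrm (u k) `^ q.
have s_le_a K : nrm (s K) `^ q <= a K.
  have [_ /le_trans] := qbl_sum (index_iota 0 K) X0 Xv; apply.
  by apply: ler_sum => k _.
have s_cauchy K L : (K <= L)%N -> nrm (fun x => s L x - s K x) `^ q <= a L - a K.
  move=> KL; have [_] := qbl_sum (index_iota K L) X0 Xv.
  rewrite (_ : (fun _ => _) = (fun x => s L x - s K x)); last first.
    apply/funext => x; rewrite /s (@big_cat_nat _ _ _ K 0%N L)//=.
    by rewrite addrAC subrr add0r.
  move=> /le_trans; apply.
  rewrite /a (@big_cat_nat _ _ _ K 0%N L)//= addrAC subrr add0r.
  by apply: ler_sum => k _.
have ha : has_sup (range a).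
  by split; [exists (a 0%N), 0%N|exists c => _ [K _ <-]; exact: leuc].
have [f Xf sf] : exists2 f, X f & nrm (fun x => s k x - f x) @[k --> \oo] --> (0 : R).
  apply: (qbl_complete hX Xs) => e e0.
  (* The tolerance is the [q]-th power of [e] because [s_cauchy] controls [q]-th powers of norms.
     Once [a K] is this close to the supremum of the nondecreasing sequence [a], all later
     increments are smaller than it. *)
  have eq0 : 0 < e `^ q by rewrite powR_gt0.
  have [_ [K _ <-] aK] := sup_adherent eq0 ha.
  have near_a k l : (K <= k)%N -> (K <= l)%N -> (l <= k)%N ->
      nrm (fun x => s k x - s l x) < e.
    move=> Kk Kl lk; apply: (lt_powR_root q0); rewrite ?(ltW e0)//.
      by apply: (qbl_norm_ge0 hX); exact: qblB.
    rewrite (le_lt_trans (s_cauchy _ _ lk))//.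
    have : a k <= sup (range a) by apply: ub_le_sup; [exact: ha.2|exists k].
    have : a K <= a l.
      rewrite /a (@big_cat_nat _ _ _ K 0%N l)//= lerDl.
      by apply: sumr_ge0 => *; exact: powR_ge0.
    move: aK; lra.
  exists K => k l Kk Kl; have [lk|/ltnW kl] := leqP l k; first exact: near_a.
  by rewrite nrmBC//; exact: near_a.
have sf0 e : 0 < e -> \forall k \near \oo, nrm (fun x => s k x - f x) < e.
  move=> e0; move/cvgrPdist_lt : sf => /(_ _ e0); apply: filterS => k.
  by rewrite sub0r normrN; apply: le_lt_trans; exact: ler_norm.
exists f; split=> //.
(* Split [f] into [f - s L] and [s L]. A norm of [f - s L] below the [1/q]-th power of [e] costs at
   most [e] after raising to the power [q]. *)
- apply/ler_addgt0Pr => e e0.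
  have /sf0 : 0 < e `^ q^-1 by rewrite powR_gt0.
  case=> L _ /(_ L (leqnn L)) /= ltL.
  have := qbl_normD hX (qblB Xf (Xs L)) (Xs L).
  under eq_fun do rewrite subrK.
  move=> /le_trans; apply; rewrite addrC lerD//.
    by rewrite (le_trans (s_le_a L))// leuc.
  rewrite nrmBC//.
  rewrite [leRHS](_ : e = (e `^ q^-1) `^ q); last first.
    by rewrite -powRrM mulVf ?gt_eqF// powRr1// ltW.
  apply: ge0_ler_powR; rewrite ?nnegrE ?powR_ge0 ?(ltW q0) ?(ltW ltL)//.
  by apply: (qbl_norm_ge0 hX); exact: qblB.
(* With [K] quantified before [Omega x], the claim is a countable intersection of almost-everywhere
   statements, so each [K] can be treated separately. *)
- suff : {ae mu, forall x, forall K, Omega x -> S K x <= normc (f x)}.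
    by apply: ae_imply => x h Ox K; exact: h.
  apply: ae_foralln => K.
  pose w x : R[i] := (Num.max (S K x - complex.Re (f x)) 0)%:C.
  have mw : @cfun_measurable _ _ G Omega w.
    apply: cfun_measurable_real; apply: measurable_maxr; last exact: measurable_cst.
    apply: measurable_funB; last by have [] := qbl_measurable hX Xf.
    have [+ _] := qbl_measurable hX (Xs K).
    by congr measurable_fun; apply/funext => x; rewrite sE.
  have w_le L : (K <= L)%N -> X w /\ nrm w <= nrm (fun x => s L x - f x).
    move=> KL; apply: (qbl_solid hX) => //; first exact: qblB.
    apply: aeW => x _; rewrite normc_real ger0_norm ?le_max ?lexx ?orbT//.
    rewrite ge_max normc_ge0 andbT.
    rewrite (le_trans _ (Re_le_normc _))// (le_trans _ (ler_norm _))//.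
    by rewrite sE raddfB/= lerD2r S_nd.
  have [Xw _] := w_le K (leqnn K).
  have /(qbl_norm_eq0 hX Xw) : nrm w = 0.
    apply/eqP; rewrite eq_le (qbl_norm_ge0 hX)// andbT.
    apply/ler_addgt0Pr => e /sf0[L _ /(_ (maxn K L) (leq_maxr _ _))/= ltL].
    have [_] := w_le _ (leq_maxl K L); move: ltL; lra.
  apply: ae_imply => x wx Ox; have /(congr1 (@complex.Re R))/= := wx Ox.
  move=> w0; have : S K x - complex.Re (f x) <= 0 by rewrite -w0 le_max lexx.
  rewrite subr_le0 => /le_trans; apply.
  by rewrite (le_trans (ler_norm _))// Re_le_normc.
Qed.

(** Reduces to [qbl_series_nat] by enumerating the indices with [pickle] and filling the gaps with
    the zero function, whence the assumption that it lies in [X]. *)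
Lemma qbl_series (I : countType) (D : set I) (u : I -> 'rV[R]_d -> R[i]) (c : R) :
  (forall i, D i -> X (u i)) -> X (fun=> 0) ->
  (\esum_(i in D) (nrm (u i) `^ q)%:E <= c%:E)%E ->
  exists f, [/\ X f, nrm f `^ q <= c &
    {ae mu, forall x, Omega x ->
       (\esum_(i in D) (normc (u i x))%:E <= (normc (f x))%:E)%E}].
Proof.
move=> Xu X0 leuc.
pose v k : 'rV[R]_d -> R[i] :=
  if pickle_inv k is Some i then if i \in D then u i else fun=> 0 else fun=> 0.
have Xv k : X (v k).
  by rewrite /v; case: (pickle_inv k) => [i|]//; case: ifPn => // /set_mem/Xu.
(* Stated for an arbitrary nonnegative functional vanishing at the zero function, since it serves
   twice: for the [q]-th power of the norm and for the modulus at a fixed point. *)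
have vE (h : ('rV[R]_d -> R[i]) -> R) : h (fun=> 0) = 0 -> (forall f, 0 <= h f) ->
    (\esum_(i in D) (h (u i))%:E = \sum_(k <oo) (h (v k))%:E)%E.
  move=> h0 h_ge0; rewrite esum_countE; last by move=> i _; rewrite lee_fin.
  apply: eq_eseriesr => k _; rewrite /v.
  by case: (pickle_inv k) => [i|]; [case: ifPn|]; rewrite ?h0.
have [|f [Xf lefc fv]] := @qbl_series_nat v c Xv.
  move=> K; rewrite -lee_fin; apply: le_trans leuc.
  rewrite (vE (fun f => nrm f `^ q)) ?nrm0 ?powR0 ?gt_eqF//; last first.
    by move=> f; exact: powR_ge0.
  rewrite -sumEFin; apply: nneseries_lim_ge => k _ _.
  by rewrite lee_fin powR_ge0.
exists f; split=> //; apply: ae_imply fv => x fv Ox.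
rewrite (vE (fun f => normc (f x))) ?normc0//; last by move=> g; exact: normc_ge0.
apply: lime_le.
  by apply: is_cvg_nneseries => k _ _; rewrite lee_fin normc_ge0.
by apply: nearW => K; rewrite sumEFin lee_fin fv.
Qed.

End Lattice.

(** * Taylor expansion *)

Section Taylor.
Context {R : realType} {d : nat}.
Implicit Types (F : 'rV[R]_d -> R[i]) (a : {ffun 'I_d -> nat}).

Lemma cfun_mderiv0 F : cfun_mderiv 0%R F = F.
Proof.
rewrite /cfun_mderiv /mderiv; have -> : flatten
    [seq nseq ((0%R : {ffun 'I_d -> nat}) i) i | i <- enum 'I_d] = [::].
  by elim: (enum 'I_d) => //= i s ->; rewrite ffunE.
by apply/funext => x /=; case: (F x).
Qed.

Lemma mnorm1_eq0 a : (mnorm1 a == 0%N) = (a == 0%R).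
Proof.
apply/idP/eqP => [|->].
  rewrite /mnorm1 sum_nat_eq0 => /forallP h; apply/ffunP => i.
  by rewrite ffunE; apply/eqP; exact: h.
by rewrite /mnorm1 big1// => i _; rewrite ffunE.
Qed.

Lemma mfact_gt0 a : (0 < mfact a)%N.
Proof. by rewrite /mfact prodn_gt0// => i; exact: fact_gt0. Qed.

Lemma monomial_le a (v : 'rV[R]_d) r : `|v| <= r -> `|monomial a v| <= r ^+ mnorm1 a.
Proof.
move=> vr; rewrite /monomial /mnorm1 normr_prod -prodrXr.
apply: ler_prod => i _; rewrite normr_ge0 normrX; apply: lerXn2r.
- by rewrite nnegrE.
- by rewrite nnegrE (le_trans _ vr).
- by apply: le_trans vr; exact: ler_coord_norm.
Qed.

(** The majorant forces absolute convergence of the Taylor series at [t], which is what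
    [sum_of_taylor_series] asks for. Every Taylor polynomial differs from its constant term [F x] by
    at most [M], and the bound passes to the limit. *)
Lemma taylor_dist F (Omega : set 'rV[R]_d) x t r M :
  sum_of_taylor_series Omega F -> Omega x -> Omega t -> `|x - t| <= r ->
  (\esum_(a in [set a | a != 0%R])
     (normc (cfun_mderiv a F x) * r ^+ mnorm1 a / (mfact a)%:R)%:E <= M%:E)%E ->
  normc (F t - F x) <= M.
Proof.
move=> tF Ox Ot xtr leM.
have r0 : 0 <= r by rewrite (le_trans _ xtr).
pose h a : R := normc (cfun_mderiv a F x) * r ^+ mnorm1 a / (mfact a)%:R.
have h_ge0 a : 0 <= h a by rewrite /h !mulr_ge0 ?normc_ge0 ?exprn_ge0 ?invr_ge0.
pose g a : R := normc (cfun_mderiv a F x) * `|monomial a (t - x)| / (mfact a)%:R.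
have g_le a : g a <= h a.
  rewrite /g /h ler_pM2r ?invr_gt0 ?ltr0n ?mfact_gt0//.
  by rewrite ler_wpM2l ?normc_ge0// monomial_le// distrC.
have sumF : taylor_summable F x t.
  apply: (@le_lt_trans _ _ (\esum_(a in setT) (h a)%:E)%E).
    by apply: le_esum => a _; rewrite lee_fin g_le.
  (* The index 0 contributes a single finite term; the other indices are bounded by [M]. *)
  rewrite (esumID [set 0%R]); last by move=> a _; rewrite lee_fin.
  rewrite !setTI esum_set1 ?lee_fin// lte_add_pinfty ?ltry//.
  rewrite (_ : ~` _ = [set a | a != 0%R]); first by rewrite (le_lt_trans leM)// ltry.
  by apply/seteqP; split=> a /eqP.
have poly_le N : normc (taylor_poly F x N t - F x) <= M.
  pose m (b : {ffun 'I_d -> 'I_N.+1}) : {ffun 'I_d -> nat} :=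
    [ffun i => nat_of_ord (b i)].
  have m_inj : injective m.
    move=> b b' /ffunP e; apply/ffunP => i; apply/val_inj.
    by have := e i; rewrite !ffunE.
  pose b0 : {ffun 'I_d -> 'I_N.+1} := [ffun=> ord0].
  have mb0 : m b0 = 0%R by apply/ffunP => i; rewrite !ffunE.
  pose P (b : {ffun 'I_d -> 'I_N.+1}) := (\sum_i b i <= N)%N && (b != b0).
  (* The index [b0] contributes exactly [F x], which cancels; only nonzero multi-indices remain. *)
  rewrite /taylor_poly (bigD1 b0)/=; last by rewrite big1// => i _; rewrite ffunE.
  rewrite -/(m b0) mb0 cfun_mderiv0 [monomial _ _]big1; last first.
    by move=> i _; rewrite ffunE.
  rewrite [mfact _]big1; last by move=> i _; rewrite ffunE.
  rewrite divr1 mulr1 addrAC subrr add0r.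
  apply: (le_trans (normc_sum _ _ _)).
  apply: (@le_trans _ _ (\sum_(b | P b) h (m b))).
    apply: ler_sum => b _; apply: le_trans (g_le _).
    by rewrite normcM normc_real normrM normfV normr_nat mulrA /g.
  rewrite -lee_fin -sumEFin; apply: le_trans leM.
  rewrite (_ : \sum_(b | _) _ = \sum_(a <- [seq m b | b in P]) (h a)%:E)%E; last first.
    by rewrite big_image.
  apply: esum_ge_uniq; first by rewrite map_inj_uniq// enum_uniq.
  move=> _ /mapP[b + ->]; rewrite mem_enum => /andP[_ bb0] /=.
  by rewrite -mb0 (inj_eq m_inj).
apply/ler_addgt0Pr => e e0.
have tN := tF x t Ox Ot sumF.
move/cvgrPdist_lt : tN => /(_ _ e0).
case=> N _ /(_ N (leqnn N)) /=.
rewrite sub0r normrN ger0_norm ?normc_ge0// => ltN.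
rewrite -(subrK (taylor_poly F x N t) (F t)) -addrA.
by rewrite (le_trans (ler_normcD _ _))// [leRHS]addrC lerD// ltW.
Qed.

End Taylor.

(** * Measurability of the extrema over cubes *)

Section RealMeasurability.
Context {disp : measure_display} {T : measurableType disp} {R : realType}.
Implicit Types (D : set T) (f g : T -> R).

Lemma measurable_fun_gt D f : measurable D ->
  (forall c, measurable (D `&` [set x | c < f x])) -> measurable_fun D f.
Proof.
move=> mD mf; apply: (measurability _ (RGenOInfty.measurableE R)) => //.
by move=> _ [_ [c ->] <-]; rewrite preimage_itvoy.
Qed.

Lemma measurable_fun_lt D f : measurable D ->
  (forall c, measurable (D `&` [set x | f x < c])) -> measurable_fun D f.
Proof.
move=> mD mf; apply: (measurability _ (RGenInftyO.measurableE R)) => //.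
by move=> _ [_ [c ->] <-]; rewrite preimage_itvNyo.
Qed.

Lemma measurable_gt D f g :
  measurable D -> measurable_fun D f -> measurable_fun D g ->
  measurable (D `&` [set x | f x < g x]).
Proof.
move=> mD mf mg.
rewrite (_ : _ `&` _ = D `&` (g \- f) @^-1` `]0, +oo[%classic).
  by apply: measurable_funB => //; exact: measurable_itv.
by rewrite preimage_itvoy; apply/seteqP; split=> x /= [Dx]; rewrite subr_gt0.
Qed.

End RealMeasurability.

Section CubeMeasurability.
Context {R : realType} {d : nat} {G : set (set 'rV[R]_d)}.
Hypothesis hG : open `<=` <<s G >>.
Local Notation T := (g_sigma_algebraType G).

Lemma open_measurable_rV (U : set 'rV[R]_d) : open U -> measurable (U : set T).
Proof. exact: hG. Qed.

Lemma continuous_measurable_rV (D : set T) (f : 'rV[R]_d -> R) :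
  measurable D -> continuous f -> measurable_fun D (f : T -> R).
Proof.
move=> mD /continuousP cf; apply: measurable_fun_gt => // c; apply: measurableI => //.
by apply: open_measurable_rV; have := cf _ (@open_gt R c).
Qed.

Lemma continuous_dist (x : 'rV[R]_d) : continuous (fun s : 'rV[R]_d => `|s - x|).
Proof.
move=> /= s A /= /(nbhs_ballP `|s - x|) [e e0 es].
apply/nbhs_ballP; exists e => //= z.
rewrite -ball_normE /ball_ /= => sz; apply: es; apply: le_lt_trans sz.
by rewrite (le_trans (ler_dist_dist _ _))// opprB addrA subrK.
Qed.

(** A ball of the sup norm is a product of intervals, so a rational can be chosen in each coordinate
    independently. *)
Lemma dense_rat_rV (U : set 'rV[R]_d) : open U -> U !=set0 ->
  exists v : 'rV[rat]_d, U (map_mx ratr v).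
Proof.
rewrite openE => oU [y /oU /nbhs_ballP[e /= e0 eU]].
have /choice[v vy] : forall i : 'I_d, exists c : rat, ball (y ord0 i) e (ratr c : R).
  move=> i; have [a [ya [c _ ca]]] :=
    @dense_rat R _ (ex_intro _ _ (ballxx (y ord0 i) e0)) (ball_open _ _).
  by exists c; rewrite ca.
exists (\row_i v i); apply: eU; split=> // i j.
by rewrite !mxE !ord1.
Qed.

(* Moving a witness [t] slightly towards [x] makes the inequality strict, so
   that [t] can be taken rational. *)
Lemma measurable_thickening (D : set T) (U : set 'rV[R]_d) (r : T -> R) :
  measurable D -> open U -> measurable_fun D r ->
  (forall x, D x -> 0 <= r x) ->
  measurable (D `&` [set x | exists2 t, U t & `|x - t| <= r x]).
Proof.
move=> mD oU mr r0.
pose E (v : 'rV[rat]_d) : set T :=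
  if `[< U (map_mx ratr v) >] then
    D `&` [set x : T | `|(x : 'rV[R]_d) - map_mx ratr v| < r x] else set0.
(* The strict inequality in [E] can never hold at radius 0, where [x] is its own only possible
   witness; the piece inside [U] covers that case. *)
rewrite (_ : _ `&` _ = (D `&` U) `|` \bigcup_v E v); last first.
  apply/seteqP; split=> [x /= [Dx [t Ut xt]]|x /=]; last first.
    move=> [[Dx Ux]|[v _]].
      by split=> //; exists (x : 'rV[R]_d) => //; rewrite subrr normr0 r0.
    rewrite /E; case: asboolP => // Uv [Dx xv]; split=> //.
    by exists (map_mx ratr v) => //; exact: ltW.
  have [xt'|xt0] := eqVneq x t; first by left; split=> //=; rewrite xt'.
  right; pose V := U `&` [set s : 'rV[R]_d | `|x - s| < r x].
  have oV : open V.
    apply: openI => //.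
    have /continuousP/(_ _ (@open_lt R (r x))) := @continuous_dist x.
    by congr open; apply/funext => s /=; rewrite distrC.
  have [|v [Uv xv]] := dense_rat_rV oV.
    move: oU; rewrite openE => /(_ _ Ut) /nbhs_ballP[e /= e0 eU].
    pose w := `|x - t|.
    have w0 : 0 < w by rewrite normr_gt0 subr_eq0.
    have we0 : 0 < w + e by rewrite addr_gt0.
    (* This point is at distance [e * w / (w + e) < e] from [t], hence still in [U], and at distance
       [w * w / (w + e) < w] from [x]. *)
    exists (t + (e / (w + e)) *: (x - t)); split.
      apply: eU; rewrite -ball_normE /ball_ /= opprD addNKr normrN normrZ.
      rewrite ger0_norm ?divr_ge0 ?ltW// -/w mulrAC ltr_pdivrMr// ltr_pM2l//.
      by rewrite ltrDl.
    rewrite /=; apply: lt_le_trans xt.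
    rewrite (_ : x - _ = (w / (w + e)) *: (x - t)); last first.
      have -> : w / (w + e) = 1 - e / (w + e).
        by field; rewrite gt_eqF.
      by rewrite scalerBl scale1r opprD addrA.
    rewrite normrZ ger0_norm ?divr_ge0 ?ltW// -/w gtr_pMl//.
    by rewrite ltr_pdivrMr// mul1r ltrDl.
  by exists v => //; rewrite /E asboolT.
apply: measurableU; first by apply: measurableI => //; exact: open_measurable_rV.
apply: countable_bigcupT_measurable => // v; rewrite /E; case: ifP => // _.
apply: measurable_gt => //; apply: continuous_measurable_rV => //.
exact: continuous_dist.
Qed.

(** Where [v i] does not vanish, [phi] is the [k i]-th root of a quotient of measurable functions,
    and countably many such regions cover [D]. It is meant for [v i] ranging over the partial
    derivatives of [F]. *)
Lemma measurable_root (D : set T) (phi : 'rV[R]_d -> R) (I : countType)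
    (k : I -> nat) (v : I -> 'rV[R]_d -> R) :
  measurable D -> (forall x, D x -> 0 <= phi x) ->
  (forall i, continuous (v i)) ->
  (forall i, measurable_fun D ((fun x => phi x ^+ k i * v i x) : T -> R)) ->
  (forall x, D x -> exists2 i, (0 < k i)%N & v i x != 0) ->
  measurable_fun D (phi : T -> R).
Proof.
move=> mD phi0 cv mphiv nz; apply: measurable_fun_gt => // c.
have [c0|c0] := ltP c 0.
  rewrite (_ : _ `&` _ = D)//; apply/seteqP; split=> [x []//|x Dx].
  by split=> //=; rewrite (lt_le_trans c0)// phi0.
(* [phi ^ k v * v - c ^ k v ^ 2 = (phi ^ k - c ^ k) v ^ 2] is positive exactly
   where [v] does not vanish and [c < phi]. *)
pose E i : set T := if (0 < k i)%N then
  D `&` [set x : T | c ^+ k i * v i x ^+ 2 < phi x ^+ k i * v i x * v i x]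
  else set0.
rewrite (_ : _ `&` _ = \bigcup_i E i); last first.
  apply/seteqP; split=> [x [Dx cx]|x [i _]].
    have [i ki vx] := nz x Dx; exists i => //; rewrite /E ki; split=> //=.
    rewrite -mulrA -expr2 ltr_pM2r; last by rewrite lt_def sqrf_eq0 vx sqr_ge0.
    by rewrite ltr_pXn2r ?nnegrE ?phi0.
  rewrite /E; case: ifP => // ki [Dx /=].
  rewrite -mulrA -expr2 => lt_v; split=> //=.
  have v0 : 0 < v i x ^+ 2.
    rewrite lt_def sqr_ge0 andbT; apply/eqP => v0.
    by move: lt_v; rewrite v0 !mulr0 ltxx.
  by move: lt_v; rewrite ltr_pM2r// ltr_pXn2r ?nnegrE ?phi0.
apply: countable_bigcupT_measurable => // i; rewrite /E; case: ifP => // _.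
have mv := @continuous_measurable_rV D _ mD (cv i).
apply: measurable_gt => //; last exact: measurable_funM.
by apply: measurable_funM => //; exact: measurable_funX.
Qed.

End CubeMeasurability.

Section Cubes.
Context {R : realType} {d : nat}.
Implicit Types (F : 'rV[R]_d -> R[i]) (Omega : set 'rV[R]_d).

Lemma continuous_normc F : cfun_continuous F -> continuous (fun x => normc (F x)).
Proof.
move=> [cRe cIm].
rewrite (_ : (fun _ => _) =
    (fun x => Num.sqrt (complex.Re (F x) ^+ 2 + complex.Im (F x) ^+ 2))).
  move=> s; have Fs := @nbhs_filter _ s.
  apply: continuous_comp; last exact: sqrt_continuous.
  by apply: cvgD; apply: cvgM; [exact: cRe|exact: cRe|exact: cIm|exact: cIm].
by apply/funext => x; case: (F x).
Qed.

(** Intersecting with [Omega] may destroy compactness, but the cube stays inside a closed box of the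
    whole space, on which the continuous modulus of [F] attains a maximum. For negative [r] the cube
    is empty. *)
Lemma has_ubound_cube Omega F x r : cfun_continuous F ->
  has_ubound [set normc (F t) | t in cube Omega x r].
Proof.
move=> /continuous_normc cF.
have [r0|r0] := ltP r 0.
  exists 0 => _ [t [_ xt] <-]; have := le_lt_trans xt r0.
  by rewrite ltNge normr_ge0.
pose K := [set s : 'rV[R]_d | forall i, `[x ord0 i - r, x ord0 i + r]%classic (s ord0 i)].
have cK : compact K.
  exact: (rV_compact (fun i => @segment_compact R (x ord0 i - r) (x ord0 i + r))).
have [|c _ Fc] := compact_EVT_max _ cK (continuous_subspaceT cF).
  by exists x => i /=; rewrite in_itv/= lerBlDr lerDl r0.
exists (normc (F c)) => _ [t [_ xt] <-]; apply: Fc; rewrite inE => i /=.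
rewrite in_itv /=.
have : `|x ord0 i - t ord0 i| <= r.
  have <- : (x - t) ord0 i = x ord0 i - t ord0 i by rewrite !mxE.
  by apply: le_trans xt; exact: ler_coord_norm.
rewrite ler_norml; lra.
Qed.

Lemma has_lbound_cube Omega F x r : has_lbound [set normc (F t) | t in cube Omega x r].
Proof. by exists 0 => _ [t _ <-]; exact: normc_ge0. Qed.

Lemma cube_nonempty Omega F x r : Omega x -> 0 <= r ->
  [set normc (F t) | t in cube Omega x r] !=set0.
Proof.
by move=> Ox r0; exists (normc (F x)), x => //; split=> //; rewrite subrr normr0.
Qed.

Variable G : set (set 'rV[R]_d).
Hypothesis hG : open `<=` <<s G >>.
Local Notation T := (g_sigma_algebraType G).

(** The supremum exceeds [c] exactly when the cube meets the open set where [c < |F|], so strict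
    superlevel sets are thickenings of open sets. The minimum is handled in the same way with strict
    sublevel sets. *)
Lemma measurable_max_cube Omega F (r : 'rV[R]_d -> R) :
  open Omega -> cfun_continuous F -> measurable_fun (Omega : set T) (r : T -> R) ->
  (forall x, Omega x -> 0 <= r x) ->
  @cfun_measurable R d G Omega (max_cube Omega r F).
Proof.
move=> oO cF mr r0; have mO := open_measurable_rV hG oO.
apply: cfun_measurable_real; apply: measurable_fun_gt => // c.
pose U := Omega `&` [set t | c < normc (F t)].
have oU : open U.
  by apply: openI => //; have /continuousP/(_ _ (@open_gt R c)) := continuous_normc cF.
have := measurable_thickening hG mO oU mr r0; congr measurable.
apply/seteqP; split=> x [Ox /=].
  move=> [t [Ot ct] xt]; split=> //=; apply: (lt_le_trans ct).
  by apply: ub_le_sup; [exact: has_ubound_cube|exists t].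
move=> /sup_gt[]; first exact: cube_nonempty (r0 _ Ox).
by move=> _ [t [Ot xt] <-] ct; split=> //; exists t.
Qed.

Lemma measurable_min_cube Omega F (r : 'rV[R]_d -> R) :
  open Omega -> cfun_continuous F -> measurable_fun (Omega : set T) (r : T -> R) ->
  (forall x, Omega x -> 0 <= r x) ->
  @cfun_measurable R d G Omega (min_cube Omega r F).
Proof.
move=> oO cF mr r0; have mO := open_measurable_rV hG oO.
apply: cfun_measurable_real; apply: measurable_fun_lt => // c.
pose U := Omega `&` [set t | normc (F t) < c].
have oU : open U.
  by apply: openI => //; have /continuousP/(_ _ (@open_lt R c)) := continuous_normc cF.
have := measurable_thickening hG mO oU mr r0; congr measurable.
apply/seteqP; split=> x [Ox /=].
  move=> [t [Ot ct] xt]; split=> //=; apply: le_lt_trans ct.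
  by apply: ge_inf; [exact: has_lbound_cube|exists t].
move=> /inf_lt[]; first exact: cube_nonempty (r0 _ Ox).
by move=> _ [t [Ot xt] <-] ct; split=> //; exists t.
Qed.

End Cubes.

(** * The two inequalities *)

Section Bernstein.
Context {R : realType} {d : nat} {G : set (set 'rV[R]_d)}.
Variables (Omega : set 'rV[R]_d) (hG : open `<=` <<s G >>) (oO : open Omega)
  (mu : {measure set (g_sigma_algebraType G) -> \bar R}) (q : R) (q0 : 0 < q).
Variables (X : set ('rV[R]_d -> R[i])) (nrm : ('rV[R]_d -> R[i]) -> R).
Hypothesis hX : quasi_banach_lattice Omega mu q X nrm.
Variables (n beta : R) (n0 : 0 < n) (phi : 'rV[R]_d -> R)
  (phi0 : forall x, Omega x -> 0 <= phi x).
Variables (B : {ffun 'I_d -> nat} -> R) (B0 : forall a, 0 < B a).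
Variable F : 'rV[R]_d -> R[i].
Hypotheses (XF : X F) (cF : cfun_continuous F) (sF : cfun_smooth F)
  (tF : sum_of_taylor_series Omega F).
Hypothesis bF : forall a : {ffun 'I_d -> nat},
  (xnorm X nrm (fun x => (phi x ^+ mnorm1 a)%:C * cfun_mderiv a F x)%R
   <= (B a * n `^ (beta * (mnorm1 a)%:R))%R%:E * xnorm X nrm F)%E.
Variables (A : R) (A0 : 0 < A).
Let r x := A * phi x / n `^ beta.
Let T := g_sigma_algebraType G.

Lemma xnormE f : X f -> xnorm X nrm f = (nrm f)%:E.
Proof. by move=> Xf; rewrite /xnorm asboolT. Qed.

Lemma radius_ge0 x : Omega x -> 0 <= r x.
Proof. by move=> /phi0 ?; rewrite /r divr_ge0 ?powR_ge0 ?mulr_ge0 ?(ltW A0). Qed.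

(** The right-hand side of [bF] is finite because [F] is in [X], while [xnorm] is infinite outside
    [X]; the inequality therefore also yields membership. *)
Lemma bernsteinP a :
  X (fun x => (phi x ^+ mnorm1 a)%:C * cfun_mderiv a F x) /\
  nrm (fun x => (phi x ^+ mnorm1 a)%:C * cfun_mderiv a F x) <=
    B a * n `^ (beta * (mnorm1 a)%:R) * nrm F.
Proof.
by have := bF a; rewrite (xnormE XF) /xnorm; case: asboolP.
Qed.

(* If all the derivatives of [F] vanish at some point then [F] is constant on
   [Omega]; otherwise [phi] is measurable, being determined by the measurable
   functions [phi ^ |a| D^a F]. *)
Lemma measurable_cube_extrema :
  @cfun_measurable R d G Omega (max_cube Omega r F) /\
  @cfun_measurable R d G Omega (min_cube Omega r F).
Proof.
have mO := open_measurable_rV hG oO.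
have [nz|] := pselect (forall x, Omega x -> exists2 a, a != 0%R & cfun_mderiv a F x != 0).
  have mphi : measurable_fun (Omega : set T) (phi : T -> R).
    (* The Boolean in the index selects the real or the imaginary part, so that a nonzero complex
       derivative gives a nonzero real [v i]. *)
    apply: (@measurable_root _ _ _ hG Omega phi ({ffun 'I_d -> nat} * bool)%type
      (fun i => mnorm1 i.1)
      (fun i => mderiv i.1
        (fun y => if i.2 then complex.Re (F y) else complex.Im (F y)))) => //.
    - by move=> [a b]; case: b; [exact: (sF.1 _).1|exact: (sF.2 _).1].
    - move=> [a b]; have [/(qbl_measurable hX)[mRe mIm] _] := bernsteinP a.
      case: b => /=; [move: mRe|move: mIm]; congr measurable_fun;
        by apply/funext => x /=; rewrite mul0r ?subr0 ?addr0.
    - move=> x /nz[a a0 Fa].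
      have : (mderiv a (fun y => complex.Re (F y)) x != 0) ||
             (mderiv a (fun y => complex.Im (F y)) x != 0).
        by move: Fa; rewrite /cfun_mderiv eq_complex /= negb_and.
      by move=> /orP[]; [exists (a, true)|exists (a, false)];
        rewrite //= lt0n mnorm1_eq0.
  have mr : measurable_fun (Omega : set T) (r : T -> R).
    have mA (c : R) : measurable_fun (Omega : set T) (cst c : T -> R).
      exact: measurable_cst.
    exact: measurable_funM (measurable_funM (mA A) mphi) (mA _).
  by split; [apply: measurable_max_cube|apply: measurable_min_cube] => //;
    exact: radius_ge0.
move=> /existsNP[x0 /not_implyP[Ox0 nF]].
have Fx0 t : Omega t -> F t = F x0.
  move=> Ot; apply/eqP; rewrite -subr_eq0; apply/eqP/eq0_normc/eqP.
  (* Taylor's bound with [M = 0]: every derivative of nonzero order vanishes at [x0], whatever the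
     distance from [x0] to [t]. *)
  rewrite eq_le normc_ge0 andbT; apply: (@taylor_dist _ _ F Omega x0 t `|x0 - t|) => //.
  rewrite esum1// => a a0; have [->|Fa] := eqVneq (cfun_mderiv a F x0) 0.
    by rewrite normc0 !mul0r.
  by exfalso; apply: nF; exists a.
have cst_cube x : Omega x ->
    [set normc (F t) | t in cube Omega x (r x)] = [set normc (F x0)].
  move=> Ox; apply/seteqP; split=> [_ [t [Ot _] <-]|_ ->]; first by rewrite Fx0.
  by exists x; rewrite ?Fx0//; split=> //; rewrite subrr normr0 radius_ge0.
split; apply: cfun_measurable_real.
- apply: (@eq_measurable_fun _ _ _ _ _ (cst (normc (F x0)))); last exact: measurable_cst.
  by move=> x /set_mem Ox; rewrite cst_cube// sup1.
- apply: (@eq_measurable_fun _ _ _ _ _ (cst (normc (F x0)))); last exact: measurable_cst.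
  by move=> x /set_mem Ox; rewrite cst_cube// inf1.
Qed.

Lemma taylor_eta_ge0 : (0 <= taylor_eta q B A)%E.
Proof. by apply: esum_ge0 => a _; rewrite lee_fin powR_ge0. Qed.

Lemma taylor_remainder e : taylor_eta q B A = e%:E ->
  exists f, [/\ X f, nrm f `^ q <= e * nrm F `^ q &
    {ae mu, forall x, Omega x -> forall t, cube Omega x (r x) t ->
       normc (F t - F x) <= normc (f x)}].
Proof.
move=> eta_e.
have nF0 := qbl_norm_ge0 hX XF.
(* [k a] collects the factors of [r x ^+ mnorm1 a / (mfact a)%:R] independent of [x]; the remaining
   power of [phi] is the one in the Bernstein inequality. *)
pose k (a : {ffun 'I_d -> nat}) : R := (A / n `^ beta) ^+ mnorm1 a / (mfact a)%:R.
have k0 a : 0 <= k a by rewrite divr_ge0// exprn_ge0// divr_ge0 ?powR_ge0// ltW.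
pose g (a : {ffun 'I_d -> nat}) x : R[i] := (phi x ^+ mnorm1 a)%:C * cfun_mderiv a F x.
pose u a x : R[i] := (k a)%:C * g a x.
have Xu a : X (u a) by apply: (qbl_scale hX); have [] := bernsteinP a.
have nu a : nrm (u a) `^ q <=
    nrm F `^ q * (A ^+ mnorm1 a * B a / (mfact a)%:R) `^ q.
  have [Xg ng] := bernsteinP a.
  rewrite -powRM//; last by rewrite divr_ge0// mulr_ge0 ?exprn_ge0// ltW.
  apply: ge0_ler_powR; rewrite ?nnegrE ?(ltW q0) ?(qbl_norm_ge0 hX)//.
    by rewrite mulr_ge0// divr_ge0// mulr_ge0 ?exprn_ge0// ltW.
  rewrite (qbl_normZ hX)// normc_real ger0_norm//.
  apply: (le_trans (ler_wpM2l (k0 a) ng)).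
  (* The power of [n] in the Bernstein inequality cancels the one in the denominator of [k a],
     leaving exactly the term of [taylor_eta]. *)
  rewrite /k powRrM powR_mulrn ?powR_ge0// expr_div_n.
  have : (n `^ beta) ^+ mnorm1 a != 0 by rewrite expf_neq0// gt_eqF ?powR_gt0.
  have : (mfact a)%:R != 0 :> R by rewrite pnatr_eq0 -lt0n mfact_gt0.
  by move=> f0 m0; rewrite le_eqVlt; apply/orP; left; apply/eqP; field; apply/andP.
have [||f [Xf nf fu]] := @qbl_series _ _ _ _ _ _ q0 _ _ hX _
    [set a : {ffun 'I_d -> nat} | a != 0%R] u (e * nrm F `^ q) (fun a _ => Xu a).
- exact: qbl0 hX _ XF.
- rewrite mulrC EFinM -eta_e /taylor_eta -esumZl ?powR_ge0//; last first.
    by move=> a _; rewrite lee_fin powR_ge0.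
  by apply: le_esum => a _; rewrite -EFinM lee_fin.
(* The majorant depends on [x] alone, so one exceptional null set serves all [t] in the cube. *)
exists f; split=> //; apply: ae_imply fu => x fx Ox t [Ot xt].
apply: (taylor_dist tF Ox Ot xt); apply: le_trans (fx Ox).
apply: le_esum => a _; rewrite lee_fin /u /g !normcM !normc_real.
rewrite (ger0_norm (k0 a)) ger0_norm ?exprn_ge0 ?phi0//.
rewrite /k /r !exprMn.
by rewrite le_eqVlt; apply/orP; left; apply/eqP; ring.
Qed.

Lemma max_cube_norm e : taylor_eta q B A = e%:E ->
  X (max_cube Omega r F) /\
  nrm (max_cube Omega r F) <= (1 + e) `^ q^-1 * nrm F.
Proof.
move=> eta_e; have [f [Xf nf Ff]] := taylor_remainder eta_e.
have e0 : 0 <= e by rewrite -lee_fin -eta_e taylor_eta_ge0.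
have nF0 := qbl_norm_ge0 hX XF.
have [XnF nnF] := qbl_normc hX XF; have [Xnf nnf] := qbl_normc hX Xf.
have Xh := qbl_add hX XnF Xnf.
have [mmax _] := measurable_cube_extrema.
have [|Xmax lemax] := qbl_solid hX mmax Xh.
  apply: ae_imply Ff => x Ff Ox; rewrite -rmorphD /max_cube !normc_real.
  rewrite [leRHS]ger0_norm ?addr_ge0 ?normc_ge0//.
  have ne := cube_nonempty F Ox (radius_ge0 Ox).
  have le_h : ubound [set normc (F t) | t in cube Omega x (r x)]
      (normc (F x) + normc (f x)).
    move=> _ [t xt <-]; rewrite -(subrK (F x) (F t)) (le_trans (ler_normcD _ _))//.
    by rewrite addrC lerD2l Ff.
  rewrite ger0_norm ?ge_sup//.
  have [y yS] := ne; apply: le_trans (ub_le_sup (has_ubound_cube _ _ _ cF) yS).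
  by have [t _ <-] := yS; exact: normc_ge0.
split=> //; apply: (le_trans lemax); apply: (le_powR_root q0).
- exact: (qbl_norm_ge0 hX).
- by rewrite mulr_ge0 ?powR_ge0.
rewrite powRM ?powR_ge0// -powRrM mulVf ?gt_eqF// powRr1 ?addr_ge0//.
apply: (le_trans (qbl_normD hX XnF Xnf)); rewrite mulrDl mul1r; apply: lerD.
  by apply: ge0_ler_powR; rewrite ?nnegrE ?(ltW q0) ?(qbl_norm_ge0 hX).
by apply: le_trans nf; apply: ge0_ler_powR;
  rewrite ?nnegrE ?(ltW q0) ?(qbl_norm_ge0 hX).
Qed.

Lemma min_cube_norm e : taylor_eta q B A = e%:E -> e < 1 ->
  X (min_cube Omega r F) /\
  (1 - e) `^ q^-1 * nrm F <= nrm (min_cube Omega r F).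
Proof.
move=> eta_e e1; have [f [Xf nf Ff]] := taylor_remainder eta_e.
have e'0 : 0 <= 1 - e by rewrite subr_ge0 ltW.
have nF0 := qbl_norm_ge0 hX XF.
have [Xnf nnf] := qbl_normc hX Xf.
have [_ mmin] := measurable_cube_extrema.
have min_ge0 x : Omega x -> 0 <= inf [set normc (F t) | t in cube Omega x (r x)].
  move=> Ox; apply: lb_le_inf; first exact: cube_nonempty (radius_ge0 Ox).
  by move=> _ [t _ <-]; exact: normc_ge0.
(* Since [x] belongs to its own cube, the minimum is at most [|F x|], and solidity puts it in
   [X]. *)
have [|Xmin _] := qbl_solid hX mmin XF.
  apply: aeW => x Ox; rewrite normc_real ger0_norm ?min_ge0//.
  apply: ge_inf; first exact: has_lbound_cube.
  by exists x => //; split=> //; rewrite subrr normr0 radius_ge0.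
split=> //.
have Xh := qbl_add hX Xmin Xnf.
have [|_ leF] := qbl_solid hX (qbl_measurable hX XF) Xh.
  apply: ae_imply Ff => x Ff Ox; rewrite -rmorphD normc_real.
  rewrite ger0_norm ?addr_ge0 ?normc_ge0 ?min_ge0// -lerBlDr.
  apply: lb_le_inf; first exact: cube_nonempty (radius_ge0 Ox).
  move=> _ [t xt <-]; rewrite lerBlDr.
  rewrite -[F x in leLHS](subKr (F t)) (le_trans (ler_normcD _ _))// lerD2l normcN.
  exact: Ff.
apply: (le_powR_root q0).
- by rewrite mulr_ge0 ?powR_ge0.
- exact: (qbl_norm_ge0 hX).
rewrite powRM ?powR_ge0// -powRrM mulVf ?gt_eqF// powRr1//.
(* Absorbing the last term into the left-hand side produces the factor [1 - e]. *)
have : nrm F `^ q <= nrm (min_cube Omega r F) `^ q + e * nrm F `^ q.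
  apply: (@le_trans _ _ (nrm (fun x => min_cube Omega r F x + (normc (f x))%:C) `^ q)).
    by apply: ge0_ler_powR; rewrite ?nnegrE ?(ltW q0) ?(qbl_norm_ge0 hX).
  apply: (le_trans (qbl_normD hX Xmin Xnf)); rewrite lerD2l.
  by apply: le_trans nf; apply: ge0_ler_powR;
  rewrite ?nnegrE ?(ltW q0) ?(qbl_norm_ge0 hX).
by rewrite mulrBl mul1r; lra.
Qed.

(** No smallness of [taylor_eta] enters: [max_cube_norm] covers every finite value, and an infinite
    value makes the left-hand side 0. This is why assertion (B) holds for all [A > 0]. *)
Lemma max_cube_xnorm :
  (((1 + taylor_eta q B A) `^ q^-1)^-1 * xnorm X nrm (max_cube Omega r F)
   <= xnorm X nrm F)%E.
Proof.
have nF0 := qbl_norm_ge0 hX XF.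
case eta_e : (taylor_eta q B A) taylor_eta_ge0 => [e||] //= e0.
  have [Xmax lemax] := max_cube_norm eta_e.
  rewrite !xnormE// inver gt_eqF; last by rewrite powR_gt0// ltr_pwDl.
  by rewrite -EFinM lee_fin ler_pdivrMl// powR_gt0// ltr_pwDl.
(* The inverse of [+oo] is 0, and 0 times any extended real, [+oo] included, is 0; membership of the
   maximum in [X] is not claimed here. *)
by rewrite invr_eq0 gt_eqF//= mul0e xnormE.
Qed.

Lemma min_cube_xnorm : (taylor_eta q B A < 1)%E ->
  (xnorm X nrm F <=
   ((1 - taylor_eta q B A) `^ q^-1)^-1 * xnorm X nrm (min_cube Omega r F))%E.
Proof.
case eta_e : (taylor_eta q B A) taylor_eta_ge0 => [e||] //= e0 e1.
have [Xmin lemin] := min_cube_norm eta_e e1.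
rewrite !xnormE// inver gt_eqF; last by rewrite powR_gt0// subr_gt0.
by rewrite -EFinM lee_fin ler_pdivlMl// powR_gt0// subr_gt0.
Qed.

End Bernstein.

Theorem theorem2p6 (R : realType) (d : nat) (hd : (0 < d)%N)
  (Omega : set 'rV[R]_d) (hOmega : domain Omega)
  (G : set (set 'rV[R]_d)) (hG : open `<=` <<s G >>)
  (mu : {measure set (g_sigma_algebraType G) -> \bar R})
  (hmu : sigma_finite (Omega : set (g_sigma_algebraType G)) mu)
  (q : R) (hq0 : 0 < q) (hq1 : q <= 1)
  (X : set ('rV[R]_d -> R[i])) (nrm : ('rV[R]_d -> R[i]) -> R)
  (hX : quasi_banach_lattice Omega mu q X nrm)
  (n : R) (hn : 0 < n)
  (Fn : set ('rV[R]_d -> R[i]))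
  (hsub : fun_subspace Fn)
  (hXC : forall F, Fn F -> X F /\ cfun_continuous F)
  (hsmooth : forall F, Fn F -> cfun_smooth F)
  (htaylor : forall F, Fn F -> sum_of_taylor_series Omega F)
  (beta : R) (hbeta : 0 < beta)
  (phi : 'rV[R]_d -> R) (hphi : forall x, Omega x -> 0 <= phi x)
  (B : {ffun 'I_d -> nat} -> R) (hB : forall a, 0 < B a)
  (hBern : forall (a : {ffun 'I_d -> nat}) F, Fn F ->
    (xnorm X nrm (fun x => (phi x ^+ mnorm1 a)%:C * cfun_mderiv a F x)%R
     <= (B a * n `^ (beta * (mnorm1 a)%:R))%R%:E * xnorm X nrm F)%E) :
  (forall F (A : R), Fn F -> 0 < A -> (taylor_eta q B A < 1)%E ->
     (((1 + taylor_eta q B A) `^ q^-1)^-1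
        * xnorm X nrm (max_cube Omega (fun x => (A * phi x / n `^ beta)%R) F)
      <= xnorm X nrm F)%E
     /\
     (xnorm X nrm F
      <= ((1 - taylor_eta q B A) `^ q^-1)^-1
        * xnorm X nrm
            (min_cube Omega (fun x => (A * phi x / n `^ beta)%R) F))%E)
  /\
  (forall F (A : R), Fn F -> 0 < A ->
     (((1 + taylor_eta q B A) `^ q^-1)^-1
        * xnorm X nrm (max_cube Omega (fun x => (A * phi x / n `^ beta)%R) F)
      <= xnorm X nrm F)%E).
Proof.
have oO : open Omega by have [] := hOmega.
split=> F A FF A0; have [XF cF] := hXC _ FF.
- move=> eta1; split.
  + exact: (max_cube_xnorm hG oO hq0 hX hn hphi hB XF cF (hsmooth _ FF)
      (htaylor _ FF) (fun a => hBern a _ FF) A0).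
  + exact: (min_cube_xnorm hG oO hq0 hX hn hphi hB XF cF (hsmooth _ FF)
      (htaylor _ FF) (fun a => hBern a _ FF) A0 eta1).
- exact: (max_cube_xnorm hG oO hq0 hX hn hphi hB XF cF (hsmooth _ FF)
    (htaylor _ FF) (fun a => hBern a _ FF) A0).
Qed.
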